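(* Let $k\in\mathbb{N}$ and let $\alpha_1,\alpha_2,\dots,\alpha_k\in\mathbb{R}$ be irrational. Then the density below exists and $$\mathrm{dens}\big(\{n\in\mathbb{N}:\gcd(n,\lfloor\alpha_1n\rfloor,\lfloor\alpha_2n^2\rfloor,\dots,\lfloor\alpha_kn^k\rfloor)=1\}\big)=\frac{1}{\zeta(k+1)}.$$
   Context: $\mathbb{N}=\{1,2,3,\dots\}$; $\lfloor x\rfloor$ is the integer part of $x\in\mathbb{R}$; $\zeta$ is the Riemann zeta function. The density of $\mathcal{A}\subseteq\mathbb{N}$ is $\mathrm{dens}\,\mathcal{A}:=\lim_{N\to\infty}|\mathcal{A}\cap\{1,\dots,N\}|/N$, when this limit exists. *)

(* Defs.v *)
From HB Require Import structures.
From mathcomp Require Import all_boot all_order all_algebra finmap.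
From mathcomp Require Import all_classical all_reals all_analysis.

Set Implicit Arguments.
Unset Strict Implicit.
Unset Printing Implicit Defensive.

Import Order.TTheory GRing.Theory Num.Theory.
Import numFieldNormedType.Exports.

Local Open Scope classical_set_scope.
Local Open Scope ring_scope.

(* The Dirichlet series 1 + 2^-s + 3^-s + ..., which is the Riemann zeta
   function at real s > 1; for s <= 1 the series diverges and the value of this
   definition is meaningless. *)
Definition riemann_zeta (R : realType) (s : R) : R :=
  limn (series (fun m : nat => m.+1%:R `^ (- s))).

(* #|A `&` {1, ..., N}| / N; the value at N = 0 is 0 and irrelevant to limits *)
Definition density_ratio (R : realType) (A : set nat) (N : nat) : R :=
  #|` fset_set (A `&` [set n | (1 <= n <= N)%N])|%:R / N%:R.

(* The density of A exists and equals d. *)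
Definition has_density (R : realType) (A : set nat) (d : R) : Prop :=
  density_ratio R A @ \oo --> d.

(* gcd(n, floor(alpha_1 n), floor(alpha_2 n^2), ..., floor(alpha_k n^k)), where
   alpha_(i+1) is [alpha i]; 0 is neutral for gcdz, and gcdz is nonnegative also
   when some of the floors are negative. *)
Definition gcd_floors (R : realType) (k : nat) (alpha : 'I_k -> R) (n : nat) :
    int :=
  gcdz n%:Z (\big[gcdz/0]_(i < k) Num.floor (alpha i * n%:R ^+ i.+1)).

(* Main.v *)
(* Write G(n) for the gcd. For n = d m, d divides floor (alpha_i n^i) iff the
   fractional part of alpha_i d^(i-1) m^i is below 1/d. By Weyl's theorem the
   points (alpha_i d^(i-1) m^i)_i are equidistributed in the k-dimensional
   torus, because the exponents are distinct and the coefficients irrational; so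
   d | G(n) has density d^-(k+1). Inclusion-exclusion turns this into the density
   beta_D of the n such that no j in [2, D] divides G(n), and
   beta_D * zeta(k+1) is the sum of n^-(k+1) over the n without divisors in
   [2, D], hence lies in [1, 1 + 1/D]. It remains to bound the upper density of
   G(n) > D, for which G(n) <= gcd(n, floor(alpha_1 n)) suffices: few lattice
   points in a thin strip have a large gcd, as distinct slopes of points with gcd
   d and abscissa at most N are (d/N)^2 apart. *)
Require Import Defs.
From HB Require Import structures.
From mathcomp Require Import all_boot all_order all_algebra finmap.
From mathcomp Require Import all_classical all_reals all_analysis.
From mathcomp Require Import ring lra zify.

Set Implicit Arguments.
Unset Strict Implicit.
Unset Printing Implicit Defensive.

Import Order.TTheory GRing.Theory Num.Theory.
Import numFieldNormedType.Exports.

Local Open Scope classical_set_scope.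
Local Open Scope ring_scope.

(** * Means of sequences and the circle *)

Definition avg (R : realType) (f : nat -> R) (N : nat) : R :=
  (\sum_(n < N) f n.+1) / N%:R.

Definition has_mean (R : realType) (f : nat -> R) (c : R) : Prop :=
  avg f @ \oo --> c.

(** The bounding sequences may change with e, and their limits need only lie within e of c:
    trigonometric approximation and a sieve with fixed D both produce bounds of this kind. *)
Lemma cvg_sandwich (R : realType) (u : nat -> R) (c : R) :
  (forall e, 0 < e -> exists v w a b, [/\ v @ \oo --> a, w @ \oo --> b,
     c - e <= a, b <= c + e & \forall N \near \oo, v N <= u N <= w N]) ->
  u @ \oo --> c.
Proof.
move=> H; apply/cvgrPdist_le => e e0.
have e20 : 0 < e / 2 by rewrite divr_gt0.
have [v [w [a [b [va wb ca bc uvw]]]]] := H _ e20.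
near=> N.
have /andP[h1 h2] : v N <= u N <= w N by near: N.
have : `|a - v N| < e / 2 by near: N; exact: cvgr_dist_lt.
have : `|b - w N| < e / 2 by near: N; exact: cvgr_dist_lt.
rewrite !ltr_norml ler_norml => /andP[h3 h4] /andP[h5 h6].
by lra.
Unshelve. all: by end_near.
Qed.

Lemma cvg_bounded_divn (R : realType) (u : nat -> R) (B : R) :
  (forall n, `|u n| <= B) -> (fun N => u N / N%:R) @ \oo --> (0 : R).
Proof.
move=> uB; apply/cvgrPdist_le => e e0; near=> N.
have N0 : 0 < N%:R :> R by rewrite ltr0n; near: N; exact: nbhs_infty_gt.
rewrite sub0r normrN normrM normfV (gtr0_norm N0) ler_pdivrMr//.
apply: le_trans (uB N) _; rewrite -ler_pdivrMl//.
by near: N; exact: nbhs_infty_ger.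
Unshelve. all: by end_near.
Qed.

Section means.
Variable R : realType.
Implicit Types f g : nat -> R.

Lemma eq_avg f g : (forall n, f n.+1 = g n.+1) -> avg f = avg g.
Proof. by move=> fg; apply/funext => N; congr (_ / _); apply: eq_bigr. Qed.

Lemma le_avg f g N : (forall n, f n.+1 <= g n.+1) -> avg f N <= avg g N.
Proof. by move=> fg; rewrite ler_wpM2r ?invr_ge0// ler_sum. Qed.

Lemma avgD f g N : avg (fun n => f n + g n) N = avg f N + avg g N.
Proof. by rewrite /avg big_split mulrDl. Qed.

Lemma avgZ a f N : avg (fun n => a * f n) N = a * avg f N.
Proof. by rewrite /avg -mulr_sumr mulrA. Qed.

Lemma avg_cst (a : R) N : (0 < N)%N -> avg (fun=> a) N = a.
Proof.
move=> N0; rewrite /avg sumr_const card_ord -[a *+ N]mulr_natr mulfK//.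
by rewrite pnatr_eq0 -lt0n.
Qed.

Lemma eq_has_mean f g c : (forall n, f n.+1 = g n.+1) ->
  has_mean f c -> has_mean g c.
Proof. by rewrite /has_mean => /eq_avg ->. Qed.

Lemma has_mean_cst (a : R) : has_mean (fun=> a) a.
Proof.
apply/cvgrPdist_le => e e0; near=> N.
rewrite avg_cst ?subrr ?normr0 ?ltW//.
by near: N; exact: nbhs_infty_gt.
Unshelve. all: by end_near.
Qed.

Lemma has_meanD f g a b : has_mean f a -> has_mean g b ->
  has_mean (fun n => f n + g n) (a + b).
Proof.
move=> fa gb; rewrite /has_mean.
have -> : avg (fun n => f n + g n) = (fun N => avg f N + avg g N) :> (nat -> R).
  by apply/funext => N; rewrite avgD.
exact: cvgD.
Qed.

Lemma has_meanZ a f c : has_mean f c -> has_mean (fun n => a * f n) (a * c).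
Proof.
move=> fc; rewrite /has_mean.
have -> : avg (fun n => a * f n) = (fun N => a * avg f N).
  by apply/funext => N; rewrite avgZ.
exact: cvgMr.
Qed.

Lemma has_mean_sum (I : Type) (r : seq I) (P : pred I) (F : I -> nat -> R)
    (c : I -> R) :
  (forall i, P i -> has_mean (F i) (c i)) ->
  has_mean (fun n => \sum_(i <- r | P i) F i n) (\sum_(i <- r | P i) c i).
Proof.
move=> Fc; elim: r => [|i r IH].
  rewrite big_nil; apply: (@eq_has_mean (fun=> 0)); last exact: has_mean_cst.
  move=> n.
  by rewrite big_nil.
rewrite big_cons; case: ifPn => Pi.
  by apply: eq_has_mean (has_meanD (Fc _ Pi) IH) => n; rewrite big_cons Pi.
by apply: eq_has_mean IH => n; rewrite big_cons (negbTE Pi).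
Qed.

Lemma has_mean_sandwich f c :
  (forall e, 0 < e -> exists g h a b, [/\ has_mean g a, has_mean h b,
     c - e <= a, b <= c + e & forall n, g n <= f n <= h n]) ->
  has_mean f c.
Proof.
move=> H; apply: cvg_sandwich => e /H[g [h [a [b [ga hb ca bc fgh]]]]].
exists (avg g), (avg h), a, b; split => //; apply: nearW => N.
by apply/andP; split; apply: le_avg => n; have /andP[] := fgh n.+1.
Qed.

Lemma sqr_avg_le f N : avg f N ^+ 2 <= avg (fun n => f n ^+ 2) N.
Proof.
case: (posnP N) => [->|N0]; first by rewrite /avg !big_ord0 !mul0r expr2 mulr0.
set a := avg f N.
have : 0 <= avg (fun n => (f n - a) ^+ 2) N.
  by rewrite divr_ge0// sumr_ge0// => i _; rewrite sqr_ge0.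
rewrite (eq_avg (g := fun n => f n ^+ 2 + (- (2 * a) * f n + a ^+ 2))); last first.
  by move=> n; ring.
rewrite !avgD avgZ avg_cst// -/a; nra.
Qed.

(** One more shift alters the sum only by its two end terms, which are bounded and vanish after
    division by N. *)
Lemma avg_shift f (B : R) h : (forall n, `|f n| <= B) ->
  (fun N => avg (fun n => f (n + h)%N) N - avg f N) @ \oo --> (0 : R).
Proof.
move=> fB; elim: h => [|h IH].
  have -> : (fun N => avg (fun n => f (n + 0)%N) N - avg f N) = fun=> 0.
    apply/funext => N; apply/eqP; rewrite subr_eq0; apply/eqP; congr (avg _ N).
    by apply/funext => n; rewrite addn0.
  exact: cvg_cst.
have Hs : (fun N => (f (N.+1 + h)%N - f (1 + h)%N) / N%:R) @ \oo --> (0 : R).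
  apply: (@cvg_bounded_divn _ _ (B + B)) => n.
  by rewrite (le_trans (ler_normB _ _))// lerD.
have key N : avg (fun n => f (n + h.+1)%N) N - avg f N =
    (f (N.+1 + h)%N - f (1 + h)%N) / N%:R +
    (avg (fun n => f (n + h)%N) N - avg f N).
  rewrite addrA; congr (_ - _); rewrite /avg -mulrDl; congr (_ / _).
  elim: N => [|N IHN]; first by rewrite !big_ord0 subrr addr0.
  rewrite !big_ord_recr /= IHN -[(N.+1 + h.+1)%N]addSnnS; ring.
by move/funext: key => ->; have := cvgD Hs IH; rewrite addr0; exact.
Qed.

End means.

Arguments has_meanZ {R} a [f c] _.

Section circle.
Variable R : realType.
Implicit Types x y : R.

(** [cosT] and [sinT] are the real and imaginary parts of e(x) = exp(2 i pi x); exponential sums are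
    handled in R through this pair. *)
Definition cosT x : R := cos (x * (pi *+ 2)).
Definition sinT x : R := sin (x * (pi *+ 2)).

Lemma cosTD x y : cosT (x + y) = cosT x * cosT y - sinT x * sinT y.
Proof. by rewrite /cosT mulrDl cosD. Qed.

Lemma cosTN x : cosT (- x) = cosT x.
Proof. by rewrite /cosT mulNr cosN. Qed.

Lemma sinTN x : sinT (- x) = - sinT x.
Proof. by rewrite /sinT mulNr sinN. Qed.

Lemma cosTB x y : cosT (x - y) = cosT x * cosT y + sinT x * sinT y.
Proof. by rewrite cosTD cosTN sinTN; ring. Qed.

Lemma cosT0 : cosT 0 = 1.
Proof. by rewrite /cosT mul0r cos0. Qed.

Lemma cosT_max x : `|cosT x| <= 1.
Proof. exact: cos_max. Qed.

Lemma cosT_geN1 x : -1 <= cosT x.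
Proof. exact: cos_geN1. Qed.

Lemma cosTM x y : cosT x * cosT y = 2^-1 * (cosT (x + y) + cosT (x - y)).
Proof. by rewrite cosTD cosTB; field. Qed.

Lemma cosTDn x (n : nat) : cosT (x + n%:R) = cosT x.
Proof.
rewrite /cosT mulrDl [n%:R * _]mulr_natl.
exact: (periodicn (@cosD2pi R)).
Qed.

Lemma cosTDz x (z : int) : cosT (x + z%:~R) = cosT x.
Proof.
case: z => n; first exact: cosTDn.
by rewrite -[LHS](cosTDn _ n.+1) NegzE mulrNz subrK.
Qed.

Definition frac x : R := x - (Num.floor x)%:~R.

Lemma frac_ge0 x : 0 <= frac x.
Proof. by rewrite subr_ge0 floor_le. Qed.

Lemma frac_lt1 x : frac x < 1.
Proof. by have := floorD1_gt x; rewrite intrD /frac; lra. Qed.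

Lemma cosT_frac x : cosT (frac x) = cosT x.
Proof. by rewrite /frac -mulrNz cosTDz. Qed.

Lemma cosT_le d x : 0 <= d -> d <= frac x <= 1 - d -> cosT x <= cosT d.
Proof.
move=> d0 /andP[h1 h2]; rewrite -cosT_frac.
have pi0 := @pi_gt0 R.
have lecos a b : 0 <= a -> a <= b -> b <= 2^-1 -> cosT b <= cosT a.
  move=> a0 ab b2; rewrite le_eqVlt; case: (eqVneq a b) => [->|anb]; first by rewrite eqxx.
  apply/orP; right; rewrite /cosT ltr_cos.
  - have ab' : a < b by rewrite lt_neqAle anb.
    by nra.
  - by rewrite in_itv /=; apply/andP; split; nra.
  - by rewrite in_itv /=; apply/andP; split; nra.
have [f2|f2] := leP (frac x) 2^-1; first exact: lecos.
(* Reflection: 1 - frac x has the same cosine and lies in [d, 1/2]. *)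
rewrite -cosTN -[cosT (- _)](cosTDn _ 1) addrC; apply: lecos => //; lra.
Qed.

Lemma cosT_lt1 x : 0 < frac x -> cosT x < 1.
Proof.
move=> f0; pose d := Num.min (frac x) (1 - frac x).
have f1 := frac_lt1 x.
have d0 : 0 < d by rewrite lt_min f0 /=; lra.
have d1 : d <= frac x by rewrite ge_min lexx.
have d2 : d <= 1 - frac x by rewrite ge_min lexx orbT.
have pi0 := @pi_gt0 R.
apply: (le_lt_trans (@cosT_le d x _ _)); rewrite ?(ltW d0)//; first lra.
have d3 : d <= 2^-1 by lra.
have dpi : 0 < d * (pi *+ 2) by rewrite mulr_gt0// pmulrn_lgt0.
rewrite /cosT -[X in _ < X](@cos0 R) ltr_cos// in_itv /= ?lexx ?pi_ge0// ltW//=.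
by nra.
Qed.

Lemma irrationalMz x (m : int) : m != 0 -> irrational x -> irrational (m%:~R * x).
Proof.
move=> m0 xi [q _ qE]; apply: xi; exists (q / m%:~R) => //.
by rewrite rmorphM fmorphV /= qE ratr_int mulrAC mulfV ?mul1r// intr_eq0.
Qed.

Lemma irrationalMn x (n : nat) : (0 < n)%N -> irrational x -> irrational (n%:R * x).
Proof. by move=> n0; apply: (@irrationalMz x n); rewrite -lt0n. Qed.

Lemma irrational_frac_gt0 x : irrational x -> 0 < frac x.
Proof.
move=> xi; rewrite lt_neqAle frac_ge0 andbT eq_sym; apply/eqP => /eqP.
rewrite subr_eq0 => /eqP xE; apply: xi.
by exists ((Num.floor x)%:~R); rewrite // ratr_int.
Qed.

End circle.

(** * Weyl's theorem *)

Lemma exists_natr_gt (R : realType) (x : R) : exists n : nat, (0 < n)%N /\ x < n%:R.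
Proof.
exists (Num.truncn `|x|).+1; split => //.
by rewrite (le_lt_trans (ler_norm x))// truncnS_gt.
Qed.

Lemma cvg_sumr (R : realType) (I : Type) (r : seq I) (P : pred I)
    (u : I -> nat -> R) (l : I -> R) : (forall i, P i -> u i @ \oo --> l i) ->
  (fun N => \sum_(i <- r | P i) u i N) @ \oo --> \sum_(i <- r | P i) l i.
Proof.
by move=> ul; apply: (@cvg_big _ _ +%R 0 P) => //; exact: add_continuous.
Qed.

Section weyl.
Variable R : realType.

(* van der Corput's trick: averaging over H consecutive shifts costs o(1), and
   by Cauchy-Schwarz the square of the resulting mean is at most the mean of
   the H^2 correlations, of which only the H diagonal ones survive. *)
Lemma van_der_corput (theta : nat -> R) :
  (forall h h' : nat, h != h' ->
     has_mean (fun n => cosT (theta (n + h)%N - theta (n + h')%N)) 0) ->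
  has_mean (fun n => cosT (theta n)) 0.
Proof.
move=> corr; apply/cvgrPdist_le => e e0.
(* For large N the square of [avg y N] is below 2 H, and H e^2 > 8 puts this under (H e / 2)^2. *)
have [H [H0 He]] := exists_natr_gt (8 / e ^+ 2).
have {}H0 : 0 < H%:R :> R by rewrite ltr0n.
have {}He : 8 < H%:R * e ^+ 2 by rewrite -ltr_pdivrMr// exprn_gt0.
pose c n := cosT (theta n).
pose y n := \sum_(h < H) cosT (theta (n + h)%N).
pose z n := \sum_(h < H) sinT (theta (n + h)%N).
(* The squared modulus of the sum of e(theta (n + h)) over h < H, expanded into its correlations. *)
have yzH : has_mean (fun n => y n ^+ 2 + z n ^+ 2) (H%:R : R).
  have -> : (H%:R : R) = \sum_(h < H) \sum_(h' < H) (h == h')%:R.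
    rewrite -[H in LHS]card_ord -sumr_const; apply: eq_bigr => h _.
    rewrite (bigD1 h)//= eqxx big1 ?addr0// => h' /negbTE.
    by rewrite eq_sym => ->.
  apply: (@eq_has_mean _ (fun n => \sum_(h < H) \sum_(h' < H)
      cosT (theta (n + h)%N - theta (n + h')%N))) => [n|].
    rewrite !expr2 !big_distrlr -big_split; apply: eq_bigr => h _ /=.
    by rewrite -big_split; apply: eq_bigr => h' _; rewrite cosTB.
  apply: has_mean_sum => h _; apply: has_mean_sum => h' _.
  have [->|hh'] := eqVneq h h'; last exact: corr.
  apply: (@eq_has_mean _ (fun=> 1)) => [n|]; first by rewrite subrr cosT0.
  exact: has_mean_cst.
have shifts : (fun N => \sum_(h < H) (avg (fun n => c (n + h)%N) N - avg c N))
    @ \oo --> (0 : R).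
  suff : (fun N => \sum_(h < H) (avg (fun n => c (n + h)%N) N - avg c N))
      @ \oo --> \sum_(h < H) (0 : R) by rewrite big1.
  apply: cvg_sumr => h _; apply: (@avg_shift _ _ 1) => n; exact: cosT_max.
have He2 : 0 < H%:R * (e / 2) by rewrite mulr_gt0// divr_gt0.
near=> N.
have : `|0 - \sum_(h < H) (avg (fun n => c (n + h)%N) N - avg c N)| < H%:R * (e / 2).
  by near: N; exact: cvgr_dist_lt.
have : `|H%:R - avg (fun n => y n ^+ 2 + z n ^+ 2) N| < H%:R.
  by near: N; exact: cvgr_dist_lt.
have yle : avg y N ^+ 2 <= avg (fun n => y n ^+ 2 + z n ^+ 2) N.
  apply: le_trans (sqr_avg_le _ _) _; apply: le_avg => n.
  by rewrite lerDl sqr_ge0.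
have -> : \sum_(h < H) (avg (fun n => c (n + h)%N) N - avg c N) =
    avg y N - H%:R * avg c N.
  rewrite sumrB sumr_const card_ord mulr_natl; congr (_ - _).
  by rewrite /avg -mulr_suml exchange_big.
rewrite -/c !ltr_norml ler_norml => /andP[h1 h2] /andP[h3 h4].
set a := avg c N in h1 h2 h3 h4 *; set b := avg y N in yle h1 h2 h3 h4 *.
have b2 : b ^+ 2 <= (H%:R * (e / 2)) ^+ 2 by nra.
have : `|b| <= H%:R * (e / 2) by rewrite -ler_sqr ?nnegrE ?(ltW He2)// real_normK ?num_real.
rewrite ler_norml => /andP[h5 h6].
by apply/andP; split; rewrite -(ler_pM2l H0); lra.
Unshelve. all: by end_near.
Qed.

(** Induction on the degree: differencing lowers it by one and multiplies the leading coefficient by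
    the nonzero integer (h - h') (k + 2), so the coefficient stays irrational. *)
Lemma weyl_mean (k : nat) (p : {poly R}) :
  (size p <= k.+2)%N -> irrational p`_k.+1 ->
  has_mean (fun n => cosT p.[n%:R]) 0.
Proof.
elim: k p => [|k IH] p sp irr.
  set a := p`_1 in irr; pose f n := cosT p.[n%:R].
  (* Linear case: this recurrence and the shift invariance of means give (2 - 2 cosT a) avg f -> 0,
     and cosT a < 1 because a is not an integer. *)
  have recf n : f (n + 2)%N + f n = 2 * cosT a * f (n + 1)%N.
    have pE x : p.[x] = p`_0 + a * x.
      by rewrite (horner_coef_wide _ sp) !big_ord_recl big_ord0 /= /bump /= addn0 expr0 expr1 /a; ring.
    rewrite /f !pE !natrD.
    set t := p`_0 + a * (n%:R + 1).
    have -> : p`_0 + a * (n%:R + 2) = t + a by rewrite /t; ring.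
    have -> : p`_0 + a * n%:R = t - a by rewrite /t; ring.
    by rewrite cosTD cosTB; ring.
  have fB n : `|f n| <= 1 by exact: cosT_max.
  have s1 := avg_shift 1 fB; have s2 := avg_shift 2 fB.
  have a1 : 0 < 2 - 2 * cosT a by have := cosT_lt1 (irrational_frac_gt0 irr); lra.
  have avgE N : avg f N = (2 - 2 * cosT a)^-1 *
      (2 * cosT a * (avg (fun n => f (n + 1)%N) N - avg f N) -
       (avg (fun n => f (n + 2)%N) N - avg f N)).
    have : avg (fun n => f (n + 2)%N) N + avg f N =
        2 * cosT a * avg (fun n => f (n + 1)%N) N.
      by rewrite -avgD -avgZ; congr (avg _ N); apply/funext.
    by move=> E; apply: (mulfI (lt0r_neq0 a1)); rewrite mulVKf ?lt0r_neq0//; lra.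
  rewrite /has_mean -/f; move/funext: avgE => ->.
  rewrite [X in _ --> X](_ : 0 = (2 - 2 * cosT a)^-1 * (2 * cosT a * 0 - 0)); last by ring.
  by apply: cvgMr; apply: cvgB => //; apply: cvgMr.
apply: van_der_corput => h h' hh'.
(* Taylor expansion of p(x + h) - p(x + h'); the terms of order 0 cancel. *)
pose q := \sum_(i < k.+2) (h%:R ^+ i.+1 - h'%:R ^+ i.+1) *: p^`N(i.+1).
have qE (x : R) : q.[x] = p.[x + h%:R] - p.[x + h'%:R].
  rewrite !(nderiv_taylor_wide (mulrC _ _) sp) [in RHS]big_ord_recl.
  rewrite [X in _ - X]big_ord_recl /= !expr0 opprD addrACA subrr add0r -sumrB.
  rewrite horner_sum; apply: eq_bigr => i _.
  by rewrite hornerZ /bump /= add1n; ring.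
have qcoef j : q`_j = \sum_(i < k.+2) (h%:R ^+ i.+1 - h'%:R ^+ i.+1) *
    (p`_(i.+1 + j) *+ 'C(i.+1 + j, i.+1)).
  by rewrite coef_sum; apply: eq_bigr => i _; rewrite coefZ coef_nderivn.
have p0 j : (k.+3 <= j)%N -> p`_j = 0 by move/leq_sizeP: sp; exact.
apply: (@eq_has_mean _ (fun n => cosT q.[n%:R])) => [n|].
  by rewrite qE !natrD.
apply: IH.
  apply/leq_sizeP => j kj; rewrite qcoef big1// => i _.
  by rewrite p0 ?mul0rn ?mulr0// addSn ltnS (leq_trans kj)// leq_addl.
rewrite qcoef big_ord_recl big1 => [|i _]; last first.
  by rewrite p0 ?mul0rn ?mulr0//= /bump /= addSn addnS; lia.
rewrite addr0 /= !expr1 add1n bin1.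
rewrite -[_ *+ k.+2]mulr_natl mulrA.
have -> : (h%:R - h'%:R) * k.+2%:R = ((h%:Z - h'%:Z) * k.+2%:Z)%:~R :> R.
  by rewrite intrM intrB.
by apply: irrationalMz => //; rewrite mulf_neq0// subr_eq0 eqz_nat.
Qed.

End weyl.

(** * Joint means of trigonometric polynomials *)

Section trig.
Variable R : realType.

(* [trig_poly t c] : t is a real trigonometric polynomial of period 1 whose
   constant coefficient is c. *)
Inductive trig_poly : (R -> R) -> R -> Prop :=
| trig_poly1 : trig_poly (fun=> 1) 1
| trig_poly_cos (m : int) (phi : R) : m != 0 ->
    trig_poly (fun x => cosT (m%:~R * x + phi)) 0
| trig_polyD t c u d : trig_poly t c -> trig_poly u d ->
    trig_poly (fun x => t x + u x) (c + d)
| trig_polyZ a t c : trig_poly t c -> trig_poly (fun x => a * t x) (a * c).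

Lemma trig_poly_cst (a : R) : trig_poly (fun=> a) a.
Proof.
have := trig_polyZ a trig_poly1; rewrite mulr1.
by have <- : (fun x : R => a * 1) = fun=> a by apply/funext => x; rewrite mulr1.
Qed.

Lemma trig_poly_sum (I : Type) (r : seq I) (P : pred I) (F : I -> R -> R)
    (c : I -> R) :
  (forall i, P i -> trig_poly (F i) (c i)) ->
  trig_poly (fun x => \sum_(i <- r | P i) F i x) (\sum_(i <- r | P i) c i).
Proof.
move=> Fc; elim: r => [|i r IH].
  rewrite big_nil; have -> : (fun x => \sum_(i <- [::] | P i) F i x) = fun=> 0.
    by apply/funext => x; rewrite big_nil.
  exact: trig_poly_cst.
have -> : (fun x => \sum_(j <- i :: r | P j) F j x) = (fun x =>
    if P i then F i x + \sum_(j <- r | P j) F j x else \sum_(j <- r | P j) F j x).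
  by apply/funext => x; rewrite big_cons.
by rewrite big_cons; case: ifP => // Pi; apply: trig_polyD => //; exact: Fc.
Qed.

(* The exponents i.+1 are pairwise distinct and smaller than the degree of q,
   so expanding the t i leaves a combination of cosines of polynomials that
   have the same leading term as q. *)
Lemma has_mean_trig_cos (b : nat -> R) (t : nat -> R -> R) (c : nat -> R)
    (r s : nat) (q : {poly R}) :
  (forall i, trig_poly (t i) (c i)) ->
  (r <= s)%N -> (size q <= s.+2)%N -> irrational q`_s.+1 ->
  has_mean (fun n => (\prod_(i < r) t i (b i * n%:R ^+ i.+1)) * cosT q.[n%:R]) 0.
Proof.
move=> tc; elim: r s q => [|r IH] s q rs sq irr.
  apply: eq_has_mean (weyl_mean sq irr) => n.
  by rewrite big_ord0 mul1r.
suff H : forall u d, trig_poly u d -> forall p : {poly R}, (size p <= s.+2)%N ->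
    irrational p`_s.+1 -> has_mean (fun n =>
      (\prod_(i < r) t i (b i * n%:R ^+ i.+1)) * (u (b r * n%:R ^+ r.+1) * cosT p.[n%:R])) 0.
  apply: eq_has_mean (H _ _ (tc r) q sq irr) => n.
  by rewrite big_ord_recr /= mulrA.
move=> u d; elim => {u d} [|m phi m0|u d u' d' _ IHu _ IHu'|a u d _ IHu] p sp pirr.
- by apply: eq_has_mean (IH _ _ (ltnW rs) sp pirr) => n; rewrite mul1r.
- pose g := (m%:~R * b r) *: 'X^(r.+1) + phi%:P.
  have gE (x : R) : g.[x] = m%:~R * (b r * x ^+ r.+1) + phi.
    by rewrite hornerD hornerZ hornerXn hornerC mulrA.
  have sg : (size g <= s.+1)%N.
    rewrite (leq_trans (size_polyD _ _))// geq_max; apply/andP; split.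
      by rewrite (leq_trans (size_scale_leq _ _))// size_polyXn.
    by rewrite (leq_trans (size_polyC_leq1 _)).
  have g0 : g`_s.+1 = 0 by move/leq_sizeP: sg; exact.
  have H1 : has_mean (fun n => (\prod_(i < r) t i (b i * n%:R ^+ i.+1)) *
      cosT (g + p).[n%:R]) 0.
    apply: (IH s _ (ltnW rs)); last by rewrite coefD g0 add0r.
    by rewrite (leq_trans (size_polyD _ _))// geq_max sp (leq_trans sg).
  have H2 : has_mean (fun n => (\prod_(i < r) t i (b i * n%:R ^+ i.+1)) *
      cosT (p - g).[n%:R]) 0.
    apply: (IH s _ (ltnW rs)); last by rewrite coefB g0 subr0.
    by rewrite (leq_trans (size_polyD _ _))// size_polyN geq_max sp (leq_trans sg).
  have := has_meanZ 2^-1 (has_meanD H1 H2); rewrite addr0 mulr0.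
  apply: eq_has_mean => n; rewrite -gE cosTM hornerD hornerD hornerN.
  by rewrite -[g.[_] - _]opprB cosTN; ring.
- have := has_meanD (IHu p sp pirr) (IHu' p sp pirr); rewrite addr0.
  by apply: eq_has_mean => n; ring.
- have := has_meanZ a (IHu p sp pirr); rewrite mulr0.
  by apply: eq_has_mean => n; ring.
Qed.

(** Induction on k, expanding the last factor: its constant term multiplies the mean of the first r
    factors, and each cosine has mean 0 against them, its argument being a polynomial of degree r +
    1 with irrational leading coefficient. *)
Lemma has_mean_trig_prod (k : nat) (b : nat -> R) (t : nat -> R -> R)
    (c : nat -> R) :
  (forall i, (i < k)%N -> irrational (b i)) -> (forall i, trig_poly (t i) (c i)) ->
  has_mean (fun n => \prod_(i < k) t i (b i * n%:R ^+ i.+1)) (\prod_(i < k) c i).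
Proof.
move=> birr tc; elim: k birr => [|r IH] birr.
  rewrite big_ord0; apply: (@eq_has_mean _ (fun=> 1)); last exact: has_mean_cst.
  by move=> n; rewrite big_ord0.
have {}IH := IH (fun i ir => birr i (ltnW ir)).
suff H : forall u d, trig_poly u d -> has_mean (fun n =>
      (\prod_(i < r) t i (b i * n%:R ^+ i.+1)) * u (b r * n%:R ^+ r.+1))
      ((\prod_(i < r) c i) * d).
  rewrite big_ord_recr; apply: eq_has_mean (H _ _ (tc r)) => n.
  by rewrite big_ord_recr.
move=> u d; elim => {u d} [|m phi m0|u d u' d' _ IHu _ IHu'|a u d _ IHu].
- by rewrite mulr1; apply: eq_has_mean IH => n; rewrite mulr1.
- pose g := (m%:~R * b r) *: 'X^(r.+1) + phi%:P.
  have gE (x : R) : g.[x] = m%:~R * (b r * x ^+ r.+1) + phi.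
    by rewrite hornerD hornerZ hornerXn hornerC mulrA.
  rewrite mulr0; apply: (@eq_has_mean _ (fun n =>
      (\prod_(i < r) t i (b i * n%:R ^+ i.+1)) * cosT g.[n%:R])) => [n|].
    by rewrite gE.
  apply: (has_mean_trig_cos _ tc (leqnn r)).
    rewrite (leq_trans (size_polyD _ _))// geq_max; apply/andP; split.
      by rewrite (leq_trans (size_scale_leq _ _))// size_polyXn.
    by rewrite (leq_trans (size_polyC_leq1 _)).
  rewrite coefD coefZ coefXn eqxx mulr1 coefC /= addr0.
  by apply: irrationalMz => //; exact: birr.
- by rewrite mulrDr; apply: eq_has_mean (has_meanD IHu IHu') => n; ring.
- by rewrite mulrCA; apply: eq_has_mean (has_meanZ a IHu) => n; ring.
Qed.

End trig.

(** * Fejer kernels *)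

Section fejer.
Variable R : realType.

Lemma frac_unique (x y : R) (z : int) : x = y + z%:~R -> 0 <= y < 1 -> frac x = y.
Proof.
move=> -> /andP[y0 y1]; rewrite /frac (@floor_def _ _ z) ?addrK// intrD.
by rewrite lerDr y0 addrC ltrD2l.
Qed.

Definition dirichlet_cos M (x : R) : R := \sum_(m < M) cosT (m%:R * x).
Definition dirichlet_sin M (x : R) : R := \sum_(m < M) sinT (m%:R * x).

(** This is |sum of e(m x) over m < M|^2 / M, a nonnegative kernel with constant coefficient 1. *)
Definition fejer M (x : R) : R :=
  M%:R^-1 * (dirichlet_cos M x ^+ 2 + dirichlet_sin M x ^+ 2).

Lemma fejer_ge0 M x : 0 <= fejer M x.
Proof. by rewrite mulr_ge0 ?invr_ge0// addr_ge0// sqr_ge0. Qed.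

Lemma sinTD (x y : R) : sinT (x + y) = sinT x * cosT y + cosT x * sinT y.
Proof. by rewrite /sinT mulrDl sinD. Qed.

Lemma cosT2DsinT2 (x : R) : cosT x ^+ 2 + sinT x ^+ 2 = 1.
Proof. exact: cos2Dsin2. Qed.

(** With z = e(x), [re] and [im] are the two parts of (1 - z) (1 + z + ... + z^(M-1)) = 1 - z^M; the
    claim compares squared moduli, as |1 - z|^2 = 2 - 2 cosT x. *)
Lemma dirichlet_geometric M (x : R) :
  (dirichlet_cos M x ^+ 2 + dirichlet_sin M x ^+ 2) * (2 - 2 * cosT x) =
  2 - 2 * cosT (M%:R * x).
Proof.
have re : dirichlet_cos M x * (1 - cosT x) + dirichlet_sin M x * sinT x =
    1 - cosT (M%:R * x).
  rewrite /dirichlet_cos /dirichlet_sin; elim: M => [|M IH].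
    by rewrite !big_ord0 mulr0n !mul0r cosT0; ring.
  by rewrite !big_ord_recr /= -[M.+1]addn1 natrD (mulrDl M%:R) mul1r cosTD; lra.
have im : dirichlet_sin M x * (1 - cosT x) - dirichlet_cos M x * sinT x =
    - sinT (M%:R * x).
  rewrite /dirichlet_cos /dirichlet_sin; elim: M {re} => [|M IH].
    by rewrite !big_ord0 mulr0n !mul0r /sinT mul0r sin0; ring.
  by rewrite !big_ord_recr /= -[M.+1]addn1 natrD (mulrDl M%:R) mul1r sinTD; lra.
have -> : 2 - 2 * cosT x = (1 - cosT x) ^+ 2 + sinT x ^+ 2.
  by have := cosT2DsinT2 x; lra.
have -> : 2 - 2 * cosT (M%:R * x) =
    (1 - cosT (M%:R * x)) ^+ 2 + (- sinT (M%:R * x)) ^+ 2.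
  by have := cosT2DsinT2 (M%:R * x); lra.
by rewrite -re -im; ring.
Qed.

(** Away from the integers the numerator 2 - 2 cosT (M x) is at most 4 and the denominator is
    bounded below, so the kernel decays like 1/M. *)
Lemma fejer_le M d (x : R) : (0 < M)%N -> 0 < d < 1 -> d <= frac x <= 1 - d ->
  fejer M x <= 4 / (M%:R * (2 - 2 * cosT d)).
Proof.
move=> M0 /andP[d0 d1] xd.
have c1 : 0 < 2 - 2 * cosT d.
  suff : cosT d < 1 by lra.
  by apply: cosT_lt1; rewrite (@frac_unique d d 0) ?addr0// d1 ltW.
have := cosT_le (ltW d0) xd.
have := dirichlet_geometric M x; have := cosT_geN1 (M%:R * x).
rewrite /fejer; have := fejer_ge0 M x; rewrite /fejer pmulr_rge0 ?invr_gt0 ?ltr0n//.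
set D := _ + _ => D0 h1 h2 h3.
rewrite invfM mulrCA ler_pM2l ?invr_gt0 ?ltr0n//.
rewrite ler_pdivlMr//; nra.
Qed.

Lemma fejerE M (x : R) :
  fejer M x = M%:R^-1 * \sum_(m < M) \sum_(m' < M) cosT ((m%:Z - m'%:Z)%:~R * x).
Proof.
rewrite /fejer !expr2 !big_distrlr -big_split; congr (_ * _).
apply: eq_bigr => m _; rewrite -big_split; apply: eq_bigr => m' _ /=.
by rewrite intrB mulrBl cosTB.
Qed.

Lemma sum_delta M : \sum_(m < M) \sum_(m' < M) (m == m')%:R = M%:R :> R.
Proof.
rewrite -[M in RHS]card_ord -sumr_const; apply: eq_bigr => m _.
rewrite (bigD1 m)//= eqxx big1 ?addr0// => m' /negbTE.
by rewrite eq_sym => ->.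
Qed.

Lemma trig_poly_fejer M (y : R) : (0 < M)%N -> trig_poly (fun x => fejer M (x - y)) 1.
Proof.
move=> M0; have -> : (1 : R) = M%:R^-1 * M%:R by rewrite mulVf// pnatr_eq0 -lt0n.
rewrite -[X in _ * X]sum_delta; under [X in trig_poly X]eq_fun do rewrite fejerE.
apply: trig_polyZ; apply: trig_poly_sum => m _; apply: trig_poly_sum => m' _.
have [->|mm'] := eqVneq m m'.
  have -> : (fun x => cosT ((m'%:Z - m'%:Z)%:~R * (x - y))) = fun=> 1.
    by apply/funext => x; rewrite subrr mul0r cosT0.
  exact: trig_poly1.
under eq_fun do rewrite mulrBr.
by apply: trig_poly_cos; rewrite subr_eq0 eqz_nat.
Qed.

(** The summand f has period L and satisfies f(j+2) + f(j) = 2 cosT a f(j+1) with a = n/L. Over a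
    full period shifts do not change the sum, so (2 - 2 cosT a) annihilates it, and a is not an
    integer. *)
Lemma sum_cosT_grid L (n : int) (x : R) : n != 0 -> (`|n| < L)%N ->
  \sum_(j < L) cosT (n%:~R * (x - j%:R / L%:R)) = 0.
Proof.
move=> n0 nL; have L0 : (0 < L%:R :> R) by rewrite ltr0n; lia.
pose a : R := n%:~R / L%:R; pose f (j : nat) := cosT (n%:~R * x - j%:R * a).
have a1 : cosT a < 1.
  have -> : cosT a = cosT (`|n|%N%:R / L%:R).
    rewrite /a natr_absz; case: (intP n) => // k; rewrite ?normrN ?intrN ?mulNr ?cosTN//.
  have aE : 0 < (`|n|%N%:R / L%:R : R) < 1.
    apply/andP; split; last by rewrite ltr_pdivrMr// mul1r ltr_nat.
    by rewrite divr_gt0// ltr0n absz_gt0.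
  have /andP[aE1 aE2] := aE.
  by apply: cosT_lt1; rewrite (@frac_unique _ (`|n|%N%:R / L%:R) 0) ?addr0// ltW.
have fE j : f j.+2 + f j = 2 * cosT a * f j.+1.
  rewrite /f -[j.+2]addn2 -[j.+1]addn1 !natrD.
  set t := n%:~R * x - (j%:R + 1) * a.
  have -> : n%:~R * x - (j%:R + 2) * a = t - a by rewrite /t; ring.
  have -> : n%:~R * x - j%:R * a = t + a by rewrite /t; ring.
  by rewrite (cosTD t a) (cosTB t a); ring.
have per j : f (j + L)%N = f j.
  rewrite /f natrD mulrDl -[L%:R * a]mulrC /a mulfVK ?lt0r_neq0// opprD addrA.
  by rewrite -intrN cosTDz.
have Sf g : (forall j, g (j + L)%N = g j) -> \sum_(j < L) g j.+1 = \sum_(j < L) g j :> R.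
  move=> gper; case: L {nL L0 a f a1 fE per} gper => [|L] gper; first by rewrite !big_ord0.
  by rewrite big_ord_recr [RHS]big_ord_recl -(gper 0%N) add0n addrC.
have S1 := Sf _ per; have S2 : \sum_(j < L) f j.+2 = \sum_(j < L) f j.+1.
  by apply: (Sf (fun j => f j.+1)) => j; rewrite -addSn per.
have : \sum_(j < L) (f j.+2 + f j) = 2 * cosT a * \sum_(j < L) f j.+1.
  by rewrite mulr_sumr; apply: eq_bigr => j _.
rewrite big_split /= S2 S1 => E.
rewrite (_ : \sum_(j < L) _ = \sum_(j < L) f j).
  have : (2 - 2 * cosT a) * \sum_(j < L) f j = 0 by lra.
  by move/eqP; rewrite mulf_eq0 => /orP[/eqP|/eqP//]; lra.
apply: eq_bigr => j _; rewrite /f /a; congr cosT; rewrite mulrBr; congr (_ - _).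
by rewrite mulrCA.
Qed.

(** Frequencies m - m' have modulus below M <= L, so summing over the grid kills all of them but m =
    m'. *)
Lemma sum_fejer_grid M L (x : R) : (0 < M <= L)%N ->
  \sum_(j < L) fejer M (x - j%:R / L%:R) = L%:R.
Proof.
case/andP=> M0 ML; under eq_bigr do rewrite fejerE.
rewrite -mulr_sumr exchange_big /=.
under eq_bigr do rewrite exchange_big /=.
rewrite (eq_bigr (fun m : 'I_M => \sum_(m' < M) L%:R * (m == m')%:R)).
  under eq_bigr do rewrite -mulr_sumr.
  by rewrite -mulr_sumr sum_delta mulrC mulfK// pnatr_eq0 -lt0n.
move=> m _; apply: eq_bigr => m' _; have [->|mm'] := eqVneq m m'.
  under eq_bigr do rewrite subrr mul0r cosT0.
  by rewrite sumr_const card_ord mulr1.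
rewrite mulr0 sum_cosT_grid ?subr_eq0 ?eqz_nat//.
by have := ltn_ord m; have := ltn_ord m'; lia.
Qed.

(** t averages Fejer kernels centred at the grid points j/L inside [u + d, v - d]. The whole grid
    averages to 1, which bounds t inside [u, v); for x outside, every centre is at distance at least
    d from x modulo 1, where the kernel is small. *)
Lemma trig_poly_interval_minorant (u v e : R) : 0 <= u -> u <= v -> v <= 1 -> 0 < e ->
  exists t c, [/\ trig_poly t c, v - u - e <= c <= 1 &
    forall x, 0 <= t x <= (u <= frac x < v)%R%:R + e].
Proof.
move=> u0 uv v1 e0; pose d := Num.min (e / 4) 2^-1.
have d0 : 0 < d by rewrite lt_min divr_gt0//= invr_gt0.
have d1 : d < 1 by rewrite gt_min; apply/orP; right; lra.
have de : d <= e / 4 by rewrite ge_min lexx.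
have c1 : 0 < 2 - 2 * cosT d.
  suff : cosT d < 1 by lra.
  by apply: cosT_lt1; rewrite (@frac_unique d d 0) ?addr0// d1 ltW.
have [M [M0 Me]] := exists_natr_gt (4 / (e * (2 - 2 * cosT d))).
have [K [K0 Ke]] := exists_natr_gt (4 / e).
(* L >= M is required by the grid identity; L >= K makes the rounding in a and b, at most 2, less
   than L e / 2, and the margins d cost another L e / 2 at most. *)
pose L := (M + K)%N.
have L0 : 0 < L%:R :> R by rewrite ltr0n addn_gt0 M0.
have Le : 4 < L%:R * e.
  by rewrite -ltr_pdivrMr// (lt_le_trans Ke)// ler_nat leq_addl.
pose a := (Num.truncn (L%:R * (u + d))).+1; pose b := Num.truncn (L%:R * (v - d)).
have aL : L%:R * (u + d) < a%:R by exact: truncnS_gt.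
have aL' : a%:R <= L%:R * (u + d) + 1.
  by rewrite -natr1 lerD2r truncn_le mulr_ge0 ?(ltW L0)// addr_ge0 ?(ltW d0).
have bL : L%:R * (v - d) < b%:R + 1 by rewrite natr1; exact: truncnS_gt.
(* A negative v - d truncates to 0, so this bound asks for 0 < b. *)
have bL' : (0 < b)%N -> b%:R <= L%:R * (v - d).
  by move=> b0; rewrite truncn_le (le_trans ler01)// -truncn_gt0.
have bleL : (b <= L)%N.
  case: (posnP b) => [->//|/bL' h]; rewrite -(ler_nat R) (le_trans h)//; nra.
pose F j x := fejer M (x - j%:R / L%:R).
exists (fun x => L%:R^-1 * \sum_(a <= j < b) F j x), (L%:R^-1 * \sum_(a <= j < b) 1).
have F0 j x : 0 <= F j x by exact: fejer_ge0.
split.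
- by apply: trig_polyZ; apply: trig_poly_sum => j _; exact: trig_poly_fejer.
- rewrite sumr_const_nat; apply/andP; split; last first.
    by rewrite ler_pdivrMl// mulr1 ler_nat (leq_trans (leq_subr _ _)).
  rewrite -ler_pdivrMl ?invr_gt0// invrK.
  apply: (@le_trans _ _ (b%:R - a%:R)); first by nra.
  have [ab|/ltnW ba] := leqP a b; first by rewrite natrB.
  by rewrite (eqP ba) subr_le0 ler_nat.
- move=> x; apply/andP; split.
    by rewrite mulr_ge0 ?invr_ge0 ?(ltW L0)// sumr_ge0.
  rewrite ler_pdivrMl//.
  have [xuv|xuv] := boolP (u <= frac x < v).
    apply: (@le_trans _ _ L%:R); last by rewrite -[leLHS]mulr1 ler_pM2l//=; lra.
    have [ab|ba] := ltnP a b; last by rewrite big_geq ?(ltW L0).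
    rewrite -[leRHS](@sum_fejer_grid M L x) ?M0 ?leq_addr// -(big_mkord xpredT (F^~ x)).
    rewrite [leRHS](@big_cat_nat _ _ _ a)//= ?(leq_trans (ltnW ab))//.
    rewrite [X in _ <= _ + X](@big_cat_nat _ _ _ b)//= ?(ltnW ab)//.
    by rewrite addrCA lerDl addr_ge0// sumr_ge0.
  rewrite add0r; apply: (@le_trans _ _ (\sum_(a <= j < b) e)).
    rewrite [leLHS]big_nat_cond [leRHS]big_nat_cond.
    apply: ler_sum => j; rewrite andbT => /andP[aj jb].
    have b0 : (0 < b)%N by rewrite (leq_trans _ jb).
    have {}bL' := bL' b0.
    have ja : u + d < j%:R / L%:R.
      by rewrite ltr_pdivlMr// mulrC (lt_le_trans aL)// ler_nat.
    have jv : j%:R / L%:R <= v - d.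
      by rewrite ler_pdivrMr// mulrC (le_trans _ bL')// ler_nat ltnW.
    rewrite (@le_trans _ _ (4 / (M%:R * (2 - 2 * cosT d))))//; last first.
      rewrite ler_pdivrMr ?mulr_gt0 ?ltr0n//.
      by move: Me; rewrite ltr_pdivrMr ?mulr_gt0// => /ltW; lra.
    apply: fejer_le => //; first by apply/andP.
    set y := j%:R / L%:R in ja jv *.
    have f0 := frac_ge0 x; have f1 := frac_lt1 x.
    (* The centre y lies to the right of x or to its left; in the first case x - y wraps around by
       1. *)
    have [xu|xu] := ltP (frac x) u.
      rewrite (@frac_unique _ (frac x - y + 1) (Num.floor x - 1)); last first.
      - by lra.
      - by rewrite intrB /frac; ring.
      by lra.
    have xv : v <= frac x by move: xuv; rewrite xu /= -leNgt.
    rewrite (@frac_unique _ (frac x - y) (Num.floor x)); last first.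
    - by lra.
    - by rewrite /frac; ring.
    by lra.
  rewrite sumr_const_nat -[e *+ _]mulr_natl ler_wpM2r ?(ltW e0)//.
  by rewrite ler_nat (leq_trans (leq_subr _ _)).
Qed.

End fejer.

(** * Equidistribution and divisibility *)

Section box.
Variable R : realType.

Lemma exprn_near (k : nat) (x e : R) : 0 < e ->
  exists2 r, 0 < r & forall y, `|x - y| < r -> `|x ^+ k - y ^+ k| < e.
Proof.
move=> e0; have /cvgr_dist_lt/(_ e e0) := @exprn_continuous R k x.
by case=> r r0 H; exists r => // y; exact: H.
Qed.

(** The increase of the product is largest when every [b i] is 1. *)
Lemma prodrD_le (k : nat) (b : nat -> R) (e : R) : 0 <= e ->
  (forall i, 0 <= b i <= 1) ->
  \prod_(i < k) (b i + e) <= \prod_(i < k) b i + ((1 + e) ^+ k - 1).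
Proof.
move=> e0 b01; elim: k => [|k IH]; first by rewrite !big_ord0 expr0; lra.
rewrite !big_ord_recr /= exprSr.
have /andP[bk0 bk1] := b01 k.
have Y0 : 0 <= \prod_(i < k) b i by apply: prodr_ge0 => i _; case/andP: (b01 i).
have X0 : 0 <= \prod_(i < k) (b i + e).
  by apply: prodr_ge0 => i _; case/andP: (b01 i) => *; rewrite addr_ge0.
have Y1 : \prod_(i < k) b i <= 1.
  by apply: prodr_ile1 => i _; exact: b01.
have E1 : 1 <= (1 + e) ^+ k by rewrite exprn_ege1// lerDl.
by move: IH Y0 X0 Y1 E1; set X := \prod_(i < k) (b i + e); set Y := \prod_(i < k) b i;
  set E := (1 + e) ^+ k => *; nra.
Qed.

Lemma has_mean_box (k d : nat) (b : nat -> R) : (0 < d)%N ->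
  (forall i, (i < k)%N -> irrational (b i)) ->
  has_mean (fun n => \prod_(i < k) (frac (b i * n%:R ^+ i.+1) < d%:R^-1)%R%:R : R)
    (d%:R^-1 ^+ k).
Proof.
move=> d0 birr; set D : R := d%:R^-1.
have D0 : 0 < D by rewrite invr_gt0 ltr0n.
have D1 : D <= 1 by rewrite invf_le1 ?ltr0n// ler1n.
apply: has_mean_sandwich => e e0.
have e20 : 0 < e / 2 by rewrite divr_gt0.
have [r1 r10 H1] := exprn_near k D e20.
have [r2 r20 H2] := exprn_near k 1 e20.
(* The points D - h, D + 2 h and 1 + h stay within the continuity radii [r1] of D and [r2] of 1. *)
pose h := Num.min D (Num.min r1 r2) / 3.
have m0 : 0 < Num.min D (Num.min r1 r2) by rewrite !lt_min D0 r10.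
have h0 : 0 < h by rewrite divr_gt0.
have hD : 3 * h <= D by rewrite /h mulrC divfK ?ge_min ?lexx// pnatr_eq0.
have hr1 : 3 * h <= r1 by rewrite /h mulrC divfK ?ge_min ?lexx ?orbT// pnatr_eq0.
have hr2 : 3 * h <= r2 by rewrite /h mulrC divfK ?ge_min ?lexx ?orbT// pnatr_eq0.
have [t [c [tc /andP[c1 _] tI]]] :=
  trig_poly_interval_minorant (lexx 0) (ltW D0) D1 h0.
have [u [c' [uc /andP[c'1 c'2] uI]]] :=
  trig_poly_interval_minorant (ltW D0) D1 (lexx 1) h0.
(* [u] approximates the complementary interval [D, 1) from below up to h, so [w] dominates the
   indicator of [0, D). *)
pose w x := 1 + h + -1 * u x.
have wc : trig_poly w (1 + h + -1 * c').
  by apply: trig_polyD; [exact: trig_poly_cst | exact: trig_polyZ].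
(* [t] may exceed the indicator by h; [E] is the resulting excess of the product of k factors. *)
pose E := (1 + h) ^+ k - 1.
exists (fun n => \prod_(i < k) t (b i * n%:R ^+ i.+1) + - E),
  (fun n => \prod_(i < k) w (b i * n%:R ^+ i.+1)), (c ^+ k + - E),
  ((1 + h + -1 * c') ^+ k).
split.
- apply: has_meanD; last exact: has_mean_cst.
  by have := has_mean_trig_prod birr (fun=> tc); rewrite prodr_const card_ord.
- by have := has_mean_trig_prod birr (fun=> wc); rewrite prodr_const card_ord.
- have : `|D ^+ k - (D - h) ^+ k| < e / 2 by apply: H1; rewrite opprB addrC subrK gtr0_norm//; lra.
  have : `|1 ^+ k - (1 + h) ^+ k| < e / 2.
    by apply: H2; rewrite opprD addrA subrr sub0r normrN gtr0_norm//; lra.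
  have : (D - h) ^+ k <= c ^+ k by apply: lerXn2r; rewrite ?nnegrE; lra.
  rewrite /E expr1n !ltr_norml => ? /andP[? ?] /andP[? ?]; lra.
- have : `|D ^+ k - (D + 2 * h) ^+ k| < e / 2.
    by apply: H1; rewrite opprD addrA subrr sub0r normrN gtr0_norm//; lra.
  have : (1 + h + -1 * c') ^+ k <= (D + 2 * h) ^+ k by apply: lerXn2r; rewrite ?nnegrE; lra.
  by rewrite !ltr_norml => ? /andP[? ?]; lra.
- move=> n; apply/andP; split.
    rewrite lerBlDr; apply: (@le_trans _ _ (\prod_(i < k) ((frac (b i * n%:R ^+ i.+1) < D)%R%:R + h))).
      apply: ler_prod => i _; have := tI (b i * n%:R ^+ i.+1).
      by rewrite frac_ge0.
    apply: (@prodrD_le k (fun i => (frac (b i * n%:R ^+ i.+1) < D)%R%:R)); first exact: ltW.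
    by move=> i; case: (_ < _); rewrite /= ?lexx ?ler01.
  apply: ler_prod => i _; have /andP[] := uI (b i * n%:R ^+ i.+1).
  rewrite frac_lt1 andbT /w [D <= _]leNgt; case: (_ < D) => /=; lra.
Qed.

Lemma cvg_divn (d : nat) : (0 < d)%N -> (fun N => N %/ d)%N @ \oo --> \oo.
Proof.
move=> d0; apply/cvgnyPge => A; near=> N.
by rewrite leq_divRL//; near: N; exact: nbhs_infty_ge.
Unshelve. all: by end_near.
Qed.

Lemma sum_multiples (d N : nat) (f : nat -> R) : (0 < d)%N ->
  \sum_(n < N) (d %| n.+1)%:R * f n.+1 = \sum_(m < N %/ d) f (d * m.+1)%N.
Proof.
move=> d0; elim: N => [|N IH]; first by rewrite div0n !big_ord0.
rewrite big_ord_recr IH divnS//=; have [dN|_] := boolP (d %| N.+1)%N.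
  rewrite mul1r add1n big_ord_recr; congr (_ + f _).
  by rewrite -(divnK dN) divnS// dN mulnC.
by rewrite mul0r addr0.
Qed.

Lemma has_mean_multiples (d : nat) (f : nat -> R) (c : R) : (0 < d)%N ->
  has_mean (fun m => f (d * m)%N) c ->
  has_mean (fun n => (d %| n)%:R * f n) (c * d%:R^-1).
Proof.
move=> d0 fc; have d0' : d%:R != 0 :> R by rewrite pnatr_eq0 -lt0n.
(* The last factor is floor(N/d) / N, written as 1/d minus a null sequence. *)
have avgE N : avg (fun n => (d %| n)%:R * f n) N =
    avg (fun m => f (d * m)%N) (N %/ d) * (d%:R^-1 - ((N %% d)%:R / d%:R) / N%:R).
  case: (posnP N) => [->|N0]; first by rewrite /avg div0n !big_ord0 !mul0r.
  have N0' : N%:R != 0 :> R by rewrite pnatr_eq0 -lt0n.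
  have -> : d%:R^-1 - ((N %% d)%:R / d%:R) / N%:R = (N %/ d)%N%:R / N%:R :> R.
    apply: (mulIf N0'); rewrite mulrBl !mulfVK//.
    by rewrite {1}(divn_eq N d) natrD natrM; field.
  rewrite mulrA; congr (_ / _).
  rewrite sum_multiples//.
  case: (posnP (N %/ d)%N) => [->|M0]; first by rewrite mulr0 big_ord0.
  by rewrite mulfVK// pnatr_eq0 -lt0n.
rewrite /has_mean; move/funext: avgE => ->.
rewrite -[X in c * X]subr0; apply: cvgM.
  exact: (cvg_comp _ _ (cvg_divn d0) fc).
apply: cvgB; first exact: cvg_cst.
apply: (@cvg_bounded_divn _ _ 1) => N.
rewrite ger0_norm ?divr_ge0// ler_pdivrMr ?ltr0n// mul1r ler_nat.
by rewrite ltnW// ltn_mod.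
Qed.

(** floor (d y) = d q means q <= y < q + 1/d, and 1/d <= 1 then forces q = floor y. *)
Lemma dvdz_floor (d : nat) (y : R) : (0 < d)%N ->
  (d %| Num.floor (d%:R * y))%Z = (frac y < d%:R^-1).
Proof.
move=> d0; have d0' : 0 < d%:R :> R by rewrite ltr0n.
apply/idP/idP => [/dvdzP[q qE]|yd].
  have := floor_itv (d%:R * y); rewrite qE intrD intrM.
  rewrite mulrC ler_pM2l// => /andP[h1 h2].
  have d1 : 1 <= d%:R :> R by rewrite ler1n.
  have yq : y - q%:~R < d%:R^-1.
    by rewrite -(ltr_pM2l d0') divff ?gt_eqF//; lra.
  rewrite (@frac_unique _ _ (y - q%:~R) q) ?subrK// subr_ge0 h1 /=.
  by rewrite (lt_le_trans yq)// invf_le1.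
have -> : Num.floor (d%:R * y) = d%:Z * Num.floor y.
  apply: floor_def; rewrite intrD intrM.
  have := frac_ge0 y; move: yd; rewrite -(ltr_pM2l d0') divff ?gt_eqF// /frac.
  by move=> h1 h2; apply/andP; split; [rewrite ler_pM2l//|]; lra.
by rewrite dvdz_mulr.
Qed.

Lemma dvdz_gcd_floors (k : nat) (alpha : 'I_k -> R) (d n : nat) :
  (d %| gcd_floors alpha n)%Z%:R =
  (d %| n)%:R * \prod_(i < k) (d %| Num.floor (alpha i * n%:R ^+ i.+1))%Z%:R :> R.
Proof.
rewrite /gcd_floors dvdz_gcd -mulnb natrM; congr (_ * _).
apply: (big_morph (fun z : int => (d %| z)%Z%:R : R)); last by rewrite dvdz0.
by move=> x y; rewrite dvdz_gcd -mulnb natrM.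
Qed.

Lemma has_mean_dvd_gcd_floors (k : nat) (alpha : 'I_k -> R) (d : nat) :
  (forall i, irrational (alpha i)) -> (0 < d)%N ->
  has_mean (fun n => (d %| gcd_floors alpha n)%Z%:R : R) (d%:R^-1 ^+ k.+1).
Proof.
move=> airr d0; under eq_fun do rewrite dvdz_gcd_floors.
rewrite exprSr; apply: has_mean_multiples => //.
(* For n = d m the i-th floor is that of d times [b i] m^(i+1). [has_mean_box] takes a sequence on
   nat, hence the extension by 0. *)
pose b i : R := if insub i is Some j then alpha j * d%:R ^+ j else 0.
have bE (i : 'I_k) : b i = alpha i * d%:R ^+ i by rewrite /b valK.
apply: eq_has_mean (@has_mean_box k d b d0 _) => [n|i ik].
  apply: eq_bigr => i _; rewrite -dvdz_floor// bE natrM exprMn (exprS d%:R).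
  by congr ((_ %| Num.floor _)%Z%:R); ring.
rewrite (bE (Ordinal ik)) mulrC -natrX.
by apply: irrationalMn => //; rewrite expn_gt0 d0.
Qed.

End box.

(** * Large gcds and the sieve *)

Section tail.
Variable R : realType.

Lemma sum_nat_bool (P : pred nat) (N : nat) :
  \sum_(n < N) (P n.+1)%:R = (count P (iota 1 N))%:R :> R.
Proof.
elim: N => [|N IH]; first by rewrite big_ord0.
by rewrite big_ord_recr IH -[N.+1]addn1 iotaD count_cat natrD /= addn0 add1n addn1.
Qed.

(** Telescoping, since 1/(x+1)^2 <= 1/x - 1/(x+1). *)
Lemma sum_inv_sqr_le (D K : nat) : (0 < D)%N ->
  \sum_(D.+1 <= d < K) (d%:R ^+ 2)^-1 <= D%:R^-1 :> R.
Proof.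
move=> D0; have [KD|DK] := leqP K D.+1; first by rewrite big_geq.
suff H j : \sum_(D.+1 <= d < D.+1 + j) (d%:R ^+ 2)^-1 <= D%:R^-1 - (D + j)%:R^-1 :> R.
  have := H (K - D.+1)%N; rewrite subnKC ?(ltnW DK)// => /le_trans; apply.
  by rewrite gerBl.
elim: j => [|j IH]; first by rewrite !addn0 subrr big_geq.
rewrite addnS big_nat_recr ?leq_addr//= addSn addnS.
set x : R := (D + j)%:R in IH *; have x0 : 0 < x by rewrite ltr0n addn_gt0 D0.
have -> : (D + j).+1%:R = x + 1 :> R by rewrite natr1.
suff : ((x + 1) ^+ 2)^-1 <= x^-1 - (x + 1)^-1 by move: IH; rewrite addSn; lra.
have -> : x^-1 - (x + 1)^-1 = (x * (x + 1))^-1.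
  by field; apply/andP; split; rewrite gt_eqF//; lra.
by rewrite lef_pV2 ?posrE ?exprn_gt0 ?mulr_gt0//; nra.
Qed.

Variable alpha : R.
Hypothesis airr : irrational alpha.

Definition gcd_floor (n : nat) : nat :=
  gcdn n `|Num.floor (alpha * n%:R)|%N.

Lemma gcd_floor_gt0 n : (0 < n)%N -> (0 < gcd_floor n)%N.
Proof. by rewrite gcdn_gt0 => ->. Qed.

(** Write n = d m with d the gcd. If m >= M > 1/e, then d <= e n. Otherwise d divides floor (d alpha
    m), so d < 1 / frac (alpha m), and these finitely many values are bounded by their sum C. *)
Lemma gcd_floor_growth (e : R) : 0 < e ->
  exists C : R, forall n, (0 < n)%N -> (gcd_floor n)%:R <= e * n%:R + C.
Proof.
move=> e0; have [M [M0 Me]] := exists_natr_gt e^-1.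
have f0 m : 0 < frac (alpha * m.+1%:R).
  by apply: irrational_frac_gt0; rewrite mulrC; exact: irrationalMn.
exists (\sum_(m < M) (frac (alpha * m.+1%:R))^-1) => n n0.
have C0 : 0 <= \sum_(m < M) (frac (alpha * m.+1%:R))^-1.
  by apply: sumr_ge0 => m _; rewrite invr_ge0 ltW.
have d0 := gcd_floor_gt0 n0; set d := gcd_floor n in d0 *.
have /dvdnP[m nE] : (d %| n)%N := dvdn_gcdl _ _.
have := dvdn_gcdr n `|Num.floor (alpha * n%:R)|%N; rewrite -/(gcd_floor n) -/d => dvd.
have m0 : (0 < m)%N by move: n0; rewrite nE muln_gt0 => /andP[].
have d0' : 0 < d%:R :> R by rewrite ltr0n.
have [Mm|mM] := leqP M m.
  rewrite (@le_trans _ _ (e * n%:R)) ?lerDl// nE natrM mulrA ler_peMl ?(ltW d0')//.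
  move: Me; rewrite -[e^-1]mulr1 ltr_pdivrMl// => /ltW h; rewrite (le_trans h)//.
  by rewrite ler_pM2l// ler_nat.
have : (d %| Num.floor (d%:R * (alpha * m%:R)))%Z.
  by rewrite mulrCA -natrM mulnC -nE /dvdz.
rewrite dvdz_floor// => h; case: m m0 mM h nE => // m _ mM h nE.
rewrite (@le_trans _ _ (frac (alpha * m.+1%:R))^-1)//.
  by rewrite -[d%:R]invrK lef_pV2 ?posrE ?invr_gt0// ltW.
rewrite (bigD1 (Ordinal (ltnW mM)))//= addrCA lerDl addr_ge0 ?mulr_ge0 ?(ltW e0)//.
by apply: sumr_ge0 => i _; rewrite invr_ge0 ltW.
Qed.

(* Distinct n with gcd_floor n = d have distinct slopes floor (alpha n) / n, and
   these differ by at least (d / N)^2; since frac (alpha n) / n is the distance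
   of the slope to alpha, it is at most Q / N when n > N / Q. *)
Lemma count_gcd_floor_eq (N Q d : nat) : (0 < N)%N -> (0 < d)%N ->
  \sum_(n < N) ((N < Q * n.+1) && (gcd_floor n.+1 == d))%N%:R <=
  N%:R * Q%:R * (d%:R ^+ 2)^-1 + 1 :> R.
Proof.
move=> N0 d0.
have N0' : 0 < N%:R :> R by rewrite ltr0n.
have d0' : 0 < d%:R :> R by rewrite ltr0n.
pose P n := (N < Q * n)%N && (gcd_floor n == d).
rewrite (sum_nat_bool P) -size_filter.
set s := [seq n <- iota 1 N | P n].
(* The distance from alpha to the slope floor (alpha n) / n in units of (d/N)^2; [phi n] is the unit
   cell containing it. *)
pose X (n : nat) := (N%:R / d%:R) ^+ 2 * (frac (alpha * n%:R) / n%:R) : R.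
pose phi n := Num.truncn (X n).
have X0 n : 0 <= X n by rewrite mulr_ge0 ?sqr_ge0// divr_ge0 ?frac_ge0.
have mem_s n : n \in s -> [/\ (0 < n)%N, (n <= N)%N, (N < Q * n)%N & gcd_floor n = d].
  by rewrite mem_filter mem_iota => /andP[/andP[? /eqP ?] /andP[? ?]].
have phi_inj : {in s &, injective phi}.
  move=> n n' /mem_s[n0 nN _ gn] /mem_s[n'0 n'N _ gn'] phiE.
  apply/eqP; apply: contraT => nn'.
  pose a := Num.floor (alpha * n%:R); pose a' := Num.floor (alpha * n'%:R).
  have an : (d %| n)%N by rewrite -gn; exact: dvdn_gcdl.
  have an' : (d %| n')%N by rewrite -gn'; exact: dvdn_gcdl.
  have /dvdzP[q aE] : (d %| a)%Z by rewrite /dvdz -gn; exact: dvdn_gcdr.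
  have /dvdzP[q' aE'] : (d %| a')%Z by rewrite /dvdz -gn'; exact: dvdn_gcdr.
  have /dvdnP[m mE] := an; have /dvdnP[m' mE'] := an'.
  (* Equal slopes make n' gcd(n, a) and n gcd(n', a') coincide; both gcds are d, so n = n'. *)
  have D0 : q * m'%:Z - q' * m%:Z != 0.
    apply: contra nn'; rewrite subr_eq0 => /eqP E.
    have E2 : (`|a| * n' = `|a'| * n)%N.
      rewrite aE aE' mE mE' !abszM /=.
      by have /(congr1 absz) := E; rewrite !abszM /= => E3; nia.
    rewrite -(eqn_pmul2l d0) -{1}gn' -{1}gn /gcd_floor !muln_gcdl -/a -/a'.
    by rewrite E2 [(n' * n)%N]mulnC.
  have D1 : 1 <= `|q%:~R * m'%:R - q'%:~R * m%:R| :> R.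
    have -> : q%:~R * m'%:R - q'%:~R * m%:R = (q * m'%:Z - q' * m%:Z)%:~R :> R.
      by rewrite intrB !intrM.
    by rewrite -intr_norm -[1]/(1%:~R) ler_int; move: D0; lia.
  have n0' : 0 < n%:R :> R by rewrite ltr0n.
  have n'0' : 0 < n'%:R :> R by rewrite ltr0n.
  (* The slopes differ by a nonzero integer over m m' = n n' / d^2 <= (N/d)^2, hence by at least one
     unit. *)
  have XE : X n - X n' = - (N%:R ^+ 2 / (n%:R * n'%:R)) * (q%:~R * m'%:R - q'%:~R * m%:R).
    rewrite /X /frac -/a -/a' aE aE' !intrM.
    have -> : n%:R = m%:R * d%:R :> R by rewrite mE natrM.
    have -> : n'%:R = m'%:R * d%:R :> R by rewrite mE' natrM.
    have dn : d%:R != 0 :> R by rewrite gt_eqF.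
    have mn : m%:R != 0 :> R by move: n0'; rewrite mE natrM; apply: contraTneq => ->; rewrite mul0r ltxx.
    have m'n : m'%:R != 0 :> R by move: n'0'; rewrite mE' natrM; apply: contraTneq => ->; rewrite mul0r ltxx.
    by field; rewrite dn mn m'n.
  have /andP[h1 h2] := truncn_itv (X0 n); have /andP[h3 h4] := truncn_itv (X0 n').
  rewrite -/(phi n) -/(phi n') phiE -natr1 in h1 h2; rewrite -/(phi n') -natr1 in h3 h4.
  have : `|X n - X n'| < 1 by rewrite ltr_norml; apply/andP; split; lra.
  rewrite XE normrM normrN ltNge; apply: contraNT => _.
  rewrite [X in X * _]ger0_norm ?divr_ge0 ?sqr_ge0 ?mulr_ge0 ?(ltW n0')// -[leLHS]mulr1 ler_pM//.
  rewrite ler_pdivlMr ?mulr_gt0// mul1r expr2 ler_pM ?ler_nat//.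
have us : uniq (map phi s) by rewrite map_inj_in_uniq// filter_uniq// iota_uniq.
set B := N%:R * Q%:R * _.
have B0 : 0 <= B by rewrite mulr_ge0 ?mulr_ge0 ?invr_ge0 ?sqr_ge0.
(* Pigeonhole: the occupied cells are distinct and numbered from 0 to floor B. *)
have : (size (map phi s) <= size (iota 0 (Num.truncn B).+1))%N.
  apply: uniq_leq_size => // _ /mapP[n /mem_s[n0 nN NQ _] ->].
  rewrite mem_iota add0n ltnS le_truncn// /X /B.
  have n0' : 0 < n%:R :> R by rewrite ltr0n.
  have NQ' : N%:R / n%:R <= Q%:R :> R.
    by rewrite ler_pdivrMr// -natrM ler_nat ltnW.
  have f1 := frac_lt1 (alpha * n%:R); have f0 := frac_ge0 (alpha * n%:R).
  have -> : (N%:R / d%:R) ^+ 2 * (frac (alpha * n%:R) / n%:R) =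
      N%:R * (N%:R / n%:R * frac (alpha * n%:R)) * (d%:R ^+ 2)^-1.
    by field; rewrite !gt_eqF.
  rewrite ler_wpM2r ?invr_ge0 ?sqr_ge0// ler_wpM2l ?(ltW N0')//.
  by rewrite -[Q%:R]mulr1 ler_pM// ?divr_ge0// ltW.
rewrite size_map size_iota -(ler_nat R) => /le_trans; apply.
by rewrite -natr1 lerD2r truncn_le.
Qed.

(** Four errors of at most e/4: the n <= N/Q, the sum of Q/d^2 over d > D, and the two parts e N / 4
    and |C| of the bound for the number of possible d, each of which costs an extra 1. *)
Lemma avg_gcd_floor_gt (e : R) : 0 < e ->
  exists D0 : nat, forall D, (D0 <= D)%N ->
    \forall N \near \oo, avg (fun n => (D < gcd_floor n)%N%:R) N <= e.
Proof.
move=> e0; have e40 : 0 < e / 4 by rewrite divr_gt0.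
have [Q [Q0 Qe]] := exists_natr_gt (e / 4)^-1.
have [D0 [D00 De]] := exists_natr_gt (Q%:R / (e / 4)).
have [C HC] := gcd_floor_growth e40.
exists D0 => D D0D; have D1 : (0 < D)%N by exact: leq_trans D0D.
have {}De : Q%:R < D%:R * (e / 4).
  by rewrite -ltr_pdivrMr// (lt_le_trans De)// ler_nat.
have {}Qe : 1 < Q%:R * (e / 4).
  by rewrite -ltr_pdivrMr// div1r.
near=> N.
have N0 : (0 < N)%N by near: N; exact: nbhs_infty_gt.
have N0' : 0 < N%:R :> R by rewrite ltr0n.
have CN : `|C| <= N%:R * (e / 4).
  by rewrite -ler_pdivrMr//; near: N; exact: nbhs_infty_ger.
rewrite /avg ler_pdivrMr//.
(* No gcd exceeds K, so d ranges over D < d <= K and the extra terms 1 add up to at most K. *)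
pose K := Num.truncn (e / 4 * N%:R + `|C|).
have KE : K%:R <= e / 4 * N%:R + `|C| by rewrite truncn_le addr_ge0// mulr_ge0// ltW.
apply: (@le_trans _ _ (\sum_(n < N) ((Q * n.+1 <= N)%N%:R +
    \sum_(D.+1 <= d < K.+1) ((N < Q * n.+1) && (gcd_floor n.+1 == d))%N%:R))).
  apply: ler_sum => n _.
  have [QN|NQ] := leqP (Q * n.+1)%N N.
    by apply: (@le_trans _ _ 1); [case: (_ < _)%N | rewrite lerDl sumr_ge0].
  rewrite add0r; case: ltnP => [Dg|_]; last exact: sumr_ge0.
  rewrite (bigD1_seq (gcd_floor n.+1)) ?iota_uniq//=; last first.
    rewrite mem_index_iota Dg /= ltnS.
    rewrite /K truncn_ge_nat ?addr_ge0 ?mulr_ge0 ?(ltW e0)//.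
    rewrite (le_trans (HC n.+1 _))// lerD ?ler_norm// ler_wpM2l ?(ltW e40)// ler_nat.
    exact: ltn_ord.
  by rewrite eqxx lerDl sumr_ge0.
rewrite big_split exchange_big /=.
have S1 : \sum_(n < N) (Q * n.+1 <= N)%N%:R <= N%:R * (e / 4) :> R.
  apply: (@le_trans _ _ (N %/ Q)%N%:R).
    rewrite (sum_nat_bool (fun n => Q * n <= N)%N) ler_nat -size_filter.
    rewrite -[leqRHS](size_iota 1); apply: uniq_leq_size.
      by rewrite filter_uniq// iota_uniq.
    move=> n; rewrite mem_filter !mem_iota => /andP[QnN /andP[-> _]] /=.
    by rewrite add1n ltnS leq_divRL// mulnC.
  have : (N %/ Q)%N%:R * Q%:R <= N%:R :> R by rewrite -natrM ler_nat leq_divM.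
  have : 0 <= (N %/ Q)%N%:R :> R by [].
  by nra.
have S2 : \sum_(D.+1 <= d < K.+1) \sum_(n < N)
    ((N < Q * n.+1) && (gcd_floor n.+1 == d))%N%:R <=
    N%:R * Q%:R * D%:R^-1 + K%:R :> R.
  apply: (@le_trans _ _ (\sum_(D.+1 <= d < K.+1) (N%:R * Q%:R * (d%:R ^+ 2)^-1 + 1))).
    rewrite [leLHS]big_nat_cond [leRHS]big_nat_cond.
    apply: ler_sum => d; rewrite andbT => /andP[Dd _].
    by apply: count_gcd_floor_eq => //; rewrite (leq_trans _ Dd).
  rewrite big_split /= -mulr_sumr lerD//.
    by rewrite ler_wpM2l ?mulr_ge0// sum_inv_sqr_le.
  by rewrite sumr_const_nat subSS ler_nat leq_subr.
have S3 : Q%:R * D%:R^-1 <= e / 4.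
  by rewrite ler_pdivrMr ?ltr0n// ltW// mulrC.
have S4 : N%:R * Q%:R * D%:R^-1 <= N%:R * (e / 4).
  by rewrite -mulrA ler_pM2l.
by lra.
Unshelve. all: by end_near.
Qed.

End tail.

(** Inclusion-exclusion as a list of pairs (coefficient, modulus): a new j multiplies the indicator
    by 1 - [j | g], and a product of two divisibility indicators is that of the lcm. *)
Lemma sieve_expansion (R : realType) (js : seq nat) : all (leq 1) js ->
  exists l : seq (R * nat), all (fun cd => 0 < cd.2)%N l /\
    forall g : nat, \sum_(cd <- l) cd.1 * (cd.2 %| g)%N%:R =
      (all (fun j => ~~ (j %| g)%N) js)%:R.
Proof.
elim: js => [_|j js IH /= /andP[j0 /IH[l [l0 lE]]]].
  by exists [:: (1, 1%N)]; split => // g; rewrite big_seq1 dvd1n mulr1.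
exists (l ++ [seq (- cd.1, lcmn j cd.2) | cd <- l]); split.
  rewrite all_cat l0 all_map; apply/allP => cd /(allP l0) cd0 /=.
  by rewrite lcmn_gt0 j0.
move=> g; rewrite big_cat big_map lE /=.
rewrite (eq_bigr (fun cd => - (j %| g)%:R * (cd.1 * (cd.2 %| g)%:R))) => [|cd _].
  by rewrite -mulr_sumr lE; case: (j %| g)%N; rewrite /= ?mulN1r ?subrr// oppr0 mul0r addr0.
by rewrite dvdn_lcm -mulnb natrM /=; ring.
Qed.

(** * The zeta function and the conclusion *)

(** [iota 2 D.-1] is 2, ..., D; composite j are kept, as the lcm expansion does not ask for
    primes. *)
Definition rough (D n : nat) : bool := all (fun j => ~~ (j %| n)%N) (iota 2 D.-1).

Lemma rough1 D : rough D 1.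
Proof. by apply/allP => j; rewrite mem_iota dvdn1 => /andP[j2 _]; rewrite gtn_eqF. Qed.

Lemma rough_gt D n : (0 < n)%N -> rough D n -> n = 1%N \/ (D < n)%N.
Proof.
move=> n0 /allP rn; case: (ltnP D n) => [|nD]; first by right.
left; apply/eqP; apply: contraT => n1.
by have := rn n; rewrite mem_iota dvdnn => /(_ _)/=; apply; lia.
Qed.

Section zeta.
Variables (R : realType) (s : nat).
Hypothesis s1 : (1 < s)%N.

Lemma sum_rough_le D N : (0 < D)%N ->
  \sum_(n < N) (rough D n.+1)%:R * (n.+1%:R ^+ s)^-1 <= 1 + D%:R^-1 :> R.
Proof.
move=> D0; apply: (@le_trans _ _ (\sum_(n < N) ((n == 0%N :> nat)%:R +
    (if (D < n.+1)%N then (n.+1%:R ^+ 2)^-1 else 0)))).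
  apply: ler_sum => n _; have n1 : 1 <= n.+1%:R :> R by rewrite ler1n.
  have [rn|_] := boolP (rough D n.+1); last first.
    by rewrite mul0r addr_ge0//; case: ifP => // _; rewrite invr_ge0 exprn_ge0.
  rewrite mul1r; case: (rough_gt (ltn0Sn n) rn) => [[n0]|Dn].
    by rewrite n0 eqxx expr1n invr1 lerDl; case: ifP => // _; rewrite invr_ge0 exprn_ge0.
  rewrite Dn ler_wpDl// lef_pV2 ?posrE ?exprn_gt0//.
  by rewrite ler_weXn2l.
rewrite big_split lerD//=.
  case: N => [|N]; first by rewrite big_ord0.
  by rewrite big_ord_recl big1 ?addr0.
rewrite -(big_mkord xpredT (fun n => if (D < n.+1)%N then (n.+1%:R ^+ 2)^-1 else 0)) -big_mkcond.
rewrite -(big_add1 _ _ 0 N.+1 (fun n => (D < n)%N) (fun n => (n%:R ^+ 2)^-1)).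
rewrite -(big_nat_widenl D.+1 1 N.+1 xpredT)//.
exact: sum_inv_sqr_le.
Qed.

Definition zeta_sum (N : nat) : R := \sum_(m < N) (m.+1%:R ^+ s)^-1.

Lemma zeta_sum_cvg : zeta_sum @ \oo --> riemann_zeta (s%:R : R).
Proof.
have -> : riemann_zeta (s%:R : R) = limn zeta_sum.
  congr (limn _); apply/funext => N; rewrite /series /= big_mkord.
  by apply: eq_bigr => m _; rewrite powRN powR_mulrn.
apply: nondecreasing_is_cvgn.
  move=> M N MN; rewrite /zeta_sum -!(big_mkord xpredT (fun m => (m.+1%:R ^+ s)^-1)).
  by rewrite [leRHS](@big_cat_nat _ _ _ M)//= lerDl sumr_ge0.
exists 2 => _ [N _ <-].
(* For D = 1 the range of excluded divisors is empty, so every n is rough and the bound is 2. *)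
have := @sum_rough_le 1 N isT; rewrite invr1; apply: le_trans.
by apply: ler_sum => m _; rewrite mul1r.
Qed.

Lemma zeta_sum_multiples d N : (0 < d)%N ->
  \sum_(n < N) (d %| n.+1)%:R * (n.+1%:R ^+ s)^-1 =
  d%:R^-1 ^+ s * zeta_sum (N %/ d).
Proof.
move=> d0; rewrite (sum_multiples _ (fun n => (n%:R ^+ s)^-1))// mulr_sumr.
by apply: eq_bigr => m _; rewrite natrM exprMn invfM exprVn.
Qed.

(** Summing the expansion against n^-s turns a modulus d into d^-s zeta(s), so the product is the
    Dirichlet series of the rough numbers; its term n = 1 gives the lower bound. *)
Lemma sieve_density D (l : seq (R * nat)) : (0 < D)%N ->
  all (fun cd => 0 < cd.2)%N l ->
  (forall g : nat, \sum_(cd <- l) cd.1 * (cd.2 %| g)%N%:R = (rough D g)%:R) ->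
  1 <= (\sum_(cd <- l) cd.1 * cd.2%:R^-1 ^+ s) * riemann_zeta (s%:R : R) <=
    1 + D%:R^-1.
Proof.
move=> D0 l0 lE; pose S N := \sum_(n < N) (rough D n.+1)%:R * (n.+1%:R ^+ s)^-1 : R.
(* The filter [cd \in l] keeps the positivity of the moduli available termwise in the limit. *)
have SE N : S N = \sum_(cd <- l | cd \in l)
    cd.1 * (cd.2%:R^-1 ^+ s * zeta_sum (N %/ cd.2)).
  rewrite -big_seq /S; under [LHS]eq_bigr do rewrite -lE mulr_suml.
  rewrite exchange_big /=; apply: eq_big_seq => cd /(allP l0) cd0.
  by rewrite -zeta_sum_multiples// mulr_sumr; apply: eq_bigr => n _; rewrite mulrA.
have Scvg : S @ \oo --> (\sum_(cd <- l) cd.1 * cd.2%:R^-1 ^+ s) * riemann_zeta (s%:R : R).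
  move/funext: SE => ->; rewrite mulr_suml big_seq.
  apply: cvg_sumr => cd /(allP l0) cd0; rewrite -mulrA.
  apply: cvgMr; apply: cvgMr; exact: (cvg_comp _ _ (cvg_divn cd0) zeta_sum_cvg).
apply/andP; split.
  apply: (cvgr_to_ge Scvg); near=> N.
  have N0 : (0 < N)%N by near: N; exact: nbhs_infty_gt.
  rewrite /S -(prednK N0) big_ord_recl rough1 expr1n invr1 mulr1 lerDl.
  by apply: sumr_ge0 => n _; rewrite mulr_ge0// invr_ge0 exprn_ge0.
apply: (cvgr_to_le Scvg); apply: nearW => N.
exact: sum_rough_le.
Unshelve. all: by end_near.
Qed.

End zeta.

Lemma density_ratioE (R : realType) (A : set nat) (P : pred nat) (N : nat) :
  (forall n, (0 < n)%N -> A n <-> P n) ->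
  density_ratio R A N = avg (fun n => (P n)%:R) N.
Proof.
move=> AP; rewrite /density_ratio /avg sum_nat_bool -size_filter; congr (_%:R / _).
have -> : fset_set (A `&` [set n | (1 <= n <= N)%N]) =
    [fset n in [seq n <- iota 1 N | P n]]%fset.
  have AE : A `&` [set n | (1 <= n <= N)%N] = [set` [seq n <- iota 1 N | P n]].
    apply/seteqP; split => n /=; rewrite mem_filter mem_iota add1n ltnS.
      by move=> [/AP An /[dup] nN /andP[n0 _]]; rewrite nN An.
    by move=> /andP[Pn /[dup] nN /andP[n0 _]]; split=> //; apply/AP.
  apply/fsetP => n; rewrite in_fset_set; last by rewrite AE; exact: finite_seq.
  by rewrite AE inE; apply/idP/idP; rewrite inE.
by rewrite card_fseq undup_id// filter_uniq// iota_uniq.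
Qed.

Lemma dvdz_biggcd (I : finType) (F : I -> int) (j : I) :
  (\big[gcdz/0]_i F i %| F j)%Z.
Proof.
have := mem_index_enum j; elim: (index_enum I) => // i r IH.
rewrite inE big_cons => /orP[/eqP->|/IH]; first exact: dvdz_gcdl.
exact/dvdz_trans/dvdz_gcdr.
Qed.

Theorem mainTheorem3 (R : realType) (k : nat) (hk : (0 < k)%N)
    (alpha : 'I_k -> R) (halpha : forall i : 'I_k, irrational (alpha i)) :
  has_density [set n : nat | (0 < n)%N /\ gcd_floors alpha n = 1]
    (riemann_zeta (k.+1%:R : R))^-1.
Proof.
pose G n := `|gcd_floors alpha n|%N; pose i0 := Ordinal hk.
have GE n : gcd_floors alpha n = G n :> int by rewrite /G /gcd_floors /gcdz.
have G_le n : (0 < n)%N -> (0 < G n)%N /\ (G n <= gcd_floor (alpha i0) n)%N.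
  move=> n0; have dvdG : (G n %| gcd_floor (alpha i0) n)%N.
    rewrite /gcd_floor dvdn_gcd; apply/andP; split.
      by rewrite /G /gcd_floors /gcdz /= dvdn_gcdl.
    have := dvdz_trans (dvdz_gcdr n%:Z _)
      (dvdz_biggcd (fun i : 'I_k => Num.floor (alpha i * n%:R ^+ i.+1)) i0).
    by rewrite expr1.
  by split; [rewrite gcdn_gt0 n0 | exact: dvdn_leq (gcd_floor_gt0 _ n0) dvdG].
apply: cvg_sandwich => e e0; have e20 : 0 < e / 2 by rewrite divr_gt0.
have [D0 tailD] := avg_gcd_floor_gt (halpha i0) e20.
have [D1 [D10 De]] := exists_natr_gt (e / 2)^-1.
pose D := maxn D0 D1; have DD0 : (0 < D)%N by rewrite (leq_trans D10)// leq_maxr.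
have {}De : D%:R^-1 <= e / 2.
  rewrite -[e / 2]invrK lef_pV2 ?posrE ?ltr0n ?invr_gt0//.
  by rewrite (le_trans (ltW De))// ler_nat leq_maxr.
have js0 : all (leq 1) (iota 2 D.-1).
  by apply/allP => j; rewrite mem_iota => /andP[/ltnW].
have [l [l0 lE]] := @sieve_expansion R _ js0.
pose b := \sum_(cd <- l) cd.1 * cd.2%:R^-1 ^+ k.+1.
have := @sieve_density R k.+1 hk D l DD0 l0 lE; rewrite -/b.
set z := riemann_zeta _ => /andP[bz1 bz2].
(* zeta >= 1 lets the error 1/D survive division by zeta. *)
have z1 : 1 <= z.
  have zcvg := @zeta_sum_cvg R k.+1 hk; rewrite -/z in zcvg.
  apply: (cvgr_to_ge zcvg); near=> N.
  have N0 : (0 < N)%N by near: N; exact: nbhs_infty_gt.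
  rewrite /zeta_sum -(prednK N0) big_ord_recl expr1n invr1 lerDl.
  by apply: sumr_ge0 => n _; rewrite invr_ge0 exprn_ge0.
have z0 : 0 < z by rewrite (lt_le_trans ltr01).
have bz3 : z^-1 <= b by rewrite -div1r ler_pdivrMr.
have bz4 : b <= z^-1 + e / 2.
  rewrite -(ler_pM2r z0) mulrDl mulVf ?gt_eqF// (le_trans bz2)// lerD2l.
  by rewrite (le_trans De)// ler_peMr// ltW.
have mean_rough : has_mean (fun n => (rough D (G n))%:R) b.
  apply: (@eq_has_mean _ (fun n => \sum_(cd <- l | cd \in l)
      cd.1 * (cd.2 %| gcd_floors alpha n)%Z%:R)) => [n|].
    by rewrite -big_seq -lE.
  rewrite /b big_seq.
  apply: has_mean_sum => cd /(allP l0) cd0; apply: has_meanZ.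
  exact: has_mean_dvd_gcd_floors.
have densE N : density_ratio R [set n | (0 < n)%N /\ gcd_floors alpha n = 1] N =
    avg (fun n => (G n == 1%N)%:R) N.
  apply: density_ratioE => n n0 /=; rewrite GE; split.
    by case=> _ [->].
  by move/eqP => ->.
(* G(n) = 1 implies that G(n) is rough, and a rough G(n) other than 1 exceeds D; the latter costs at
   most the tail e/2. *)
exists (fun N => avg (fun n => (rough D (G n))%:R) N - e / 2),
  (avg (fun n => (rough D (G n))%:R)), (b - e / 2), b; split => //.
- by apply: cvgB => //; exact: cvg_cst.
- by lra.
- by lra.
near=> N; rewrite densE.
have tailN : avg (fun n => (D < gcd_floor (alpha i0) n)%N%:R) N <= e / 2.
  by near: N; apply: tailD; exact: leq_maxl.
apply/andP; split.
  rewrite lerBlDr; apply: le_trans (lerD (lexx _) tailN); rewrite -avgD.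
  apply: le_avg => n; have [G0 Gle] := G_le _ (ltn0Sn n).
  have [rG|_] := boolP (rough D _); last by rewrite addr_ge0.
  have [->|DG] := rough_gt G0 rG; first by rewrite eqxx lerDl.
  by rewrite (leq_trans DG Gle) lerDr.
apply: le_avg => n; case: eqP => [->|_]; last by [].
by rewrite rough1.
Unshelve. all: by end_near.
Qed.
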